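(* Let $n\ge1$ and let $\mathcal{B}_n$ be the arrangement in $\mathbb{R}^n$ with hyperplanes $$x_i=-\tfrac32,-\tfrac12,\tfrac12\ (1\le i\le n),\qquad x_i+x_j=-2,-1,0,\qquad x_i-x_j=-1,0,1\ (1\le i<j\le n).$$ Then the number of bounded regions of $\mathcal{B}_n$ is $$2^n\,n!\binom{2n-1}{n}.$$
   Context: A region of an arrangement in $\mathbb{R}^n$ is a connected component of the complement of the union of its hyperplanes. A region is bounded if its intersection with the subspace spanned by the normal vectors to the hyperplanes is bounded. $\mathcal{B}_n$ is the translate (by $X_i=x_i+\tfrac12$) of the type $B$ Catalan arrangement $X_i=-1,0,1$; $X_i\pm X_j=-1,0,1$. *)

(* Defs.v *)
From mathcomp Require Import all_boot all_order all_algebra.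
From mathcomp Require Import all_classical all_reals topology normedtype.

Set Implicit Arguments.
Unset Strict Implicit.
Unset Printing Implicit Defensive.

Import Order.TTheory GRing.Theory Num.Theory.
Import numFieldTopology.Exports numFieldNormedType.Exports.

Local Open Scope classical_set_scope.
Local Open Scope ring_scope.

Section Arrangements.
Variables (R : realType) (n : nat).

(* The pair (a, b) stands for the hyperplane a . x = b, with a != 0.          *)
Definition arrangement : Type := seq ('rV[R]_n * R).

Definition hyperplane (h : 'rV[R]_n * R) : set 'rV[R]_n :=
  [set x | \sum_(i < n) h.1 0 i * x 0 i = h.2].

Definition arr_complement (A : arrangement) : set 'rV[R]_n :=
  ~` (\bigcup_(h in [set h | h \in A]) hyperplane h).

Definition region (A : arrangement) : set (set 'rV[R]_n) :=
  [set connected_component (arr_complement A) x | x in arr_complement A].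

Definition normal_span (A : arrangement) : {vspace 'rV[R]_n} :=
  <<[seq h.1 | h <- A]>>%VS.

Definition bounded_region (A : arrangement) : set (set 'rV[R]_n) :=
  [set C | region A C /\ bounded_set (C `&` [set x | x \in normal_span A])].

End Arrangements.

Section TypeBCatalan.
Variables (R : realType) (n : nat).

Let e (i : 'I_n) : 'rV[R]_n := delta_mx 0 i.

Let ltpairs : seq ('I_n * 'I_n) := [seq p : 'I_n * 'I_n <- enum {: 'I_n * 'I_n} | (p.1 < p.2)%N].

(* The hyperplanes X_i = -1, 0, 1 and X_i +- X_j = -1, 0, 1 in the            *)
(* coordinates x_i = X_i - 1/2.                                               *)
Definition catalanB : arrangement R n :=
  [seq (e i, c) | i <- enum 'I_n, c <- [:: - (3 / 2); - (1 / 2); 1 / 2]]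
  ++ [seq (e p.1 + e p.2, c) | p <- ltpairs, c <- [:: -2; -1; 0]]
  ++ [seq (e p.1 - e p.2, c) | p <- ltpairs, c <- [:: -1; 0; 1]].

End TypeBCatalan.

(* Main.v *)
Require Import Defs.
From mathcomp Require Import all_boot all_order all_algebra all_fingroup.
From mathcomp Require Import all_classical all_reals interval_inference.
From mathcomp Require Import topology normedtype.
From mathcomp Require Import ring lra zify.

(* In the coordinates X_i = x_i + 1/2 the arrangement is invariant under signed
   permutations and contains the reflecting hyperplanes X_i = 0, X_i = +-X_j.
   Hence a region is determined by the signs of the X_i, the ordering of the
   |X_i|, and a region of the chamber 0 = Y_0 < Y_1 < ... < Y_n cut by the
   hyperplanes r = 1, r a positive root.  In that chamber the roots
   Y_b - Y_(b-1), ..., Y_b - Y_0, Y_b + Y_1, ..., Y_b + Y_(b-1) increase, so a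
   region is encoded by the numbers c_b of those that are < 1.  The realizable
   codes are those with c_(b+1) <= c_b + 1 (c_(b+1) <= c_b + 2 if c_b is
   maximal), and the region is bounded exactly when c_b > 0 for all b, i.e. when
   all simple roots are < 1.  The number of codes of length b with last entry
   at least v is the sum of the binomials C(2b-1-v, u) for b-v <= u <= b. *)

Set Implicit Arguments.
Unset Strict Implicit.
Unset Printing Implicit Defensive.

Import Order.TTheory GRing.Theory Num.Theory.
Import numFieldTopology.Exports numFieldNormedType.Exports.

Local Open Scope classical_set_scope.
Local Open Scope ring_scope.

(** * Counting the codes of bounded regions *)

Section CodeCount.
Local Open Scope nat_scope.

(* The codes (0, c_1, ..., c_n); the leading 0 makes [nth 0 s b] equal c_b. *)
Fixpoint bcodes (n : nat) : seq (seq nat) :=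
  if n is m.+1 then
    [seq rcons s v | s <- bcodes m,
                     v <- iota 1 ((last 0 s).+1 + ((last 0 s).+1 == m.*2))]
  else [:: [:: 0]].

Lemma bcodesS n : bcodes n.+1 =
  [seq rcons s v | s <- bcodes n,
                   v <- iota 1 ((last 0 s).+1 + ((last 0 s).+1 == n.*2))].
Proof. by []. Qed.

Definition tailcount b v := count (fun s => v <= last 0 s) (bcodes b).

Definition lowbin N k := \sum_(u < k) 'C(N, u).

Lemma lowbinS N k : lowbin N.+1 k = lowbin N k + lowbin N k.-1.
Proof.
case: k => [|k]; first by rewrite /lowbin !big_ord0.
rewrite /lowbin big_ord_recl bin0 /= [in RHS]big_ord_recl bin0 -addnA; congr (_ + _).
by rewrite -big_split /=; apply: eq_bigr => i _; rewrite binS.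
Qed.

Lemma last_bcodes b s : s \in bcodes b -> last 0 s <= b.*2.-1.
Proof.
elim: b s => [|b IH] s; first by rewrite inE => /eqP->.
move=> /allpairsPdep[t [v [/IH tb]]]; rewrite mem_iota => + ->.
by rewrite last_rcons; case: eqP; lia.
Qed.

Lemma last_bcodesS_gt0 b s : s \in bcodes b.+1 -> 0 < last 0 s.
Proof.
by move=> /allpairsPdep[t [v [_]]]; rewrite mem_iota => + ->; rewrite last_rcons; lia.
Qed.

(** A code extends by the entry [v] in at most one way, namely when its range of next entries
    reaches [v]. *)
Lemma count_last_bcodesS b v : 0 < v ->
  count (fun s => last 0 s == v) (bcodes b.+1) =
  count (fun s => v <= (last 0 s).+1 + ((last 0 s).+1 == b.*2)) (bcodes b).
Proof.
move=> v0; rewrite bcodesS count_flatten -map_comp sumnE big_map -sum1_count.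
rewrite [RHS]big_mkcond.
apply: eq_bigr => s _; rewrite [LHS]count_map.
rewrite (eq_count (a2 := pred1 v)); last by move=> w /=; rewrite last_rcons.
rewrite count_uniq_mem ?iota_uniq// mem_iota.
rewrite v0 add1n ltnS.
by case: (_ <= _).
Qed.

Lemma tailcountE b v : tailcount b v =
  count (fun s => last 0 s == v) (bcodes b) + tailcount b v.+1.
Proof.
rewrite /tailcount -count_predUI.
rewrite (eq_count (a2 := fun s => v <= last 0 s)); last first.
  by move=> s /=; lia.
rewrite -[LHS]addn0; congr (_ + _); rewrite (eq_count (a2 := pred0)) ?count_pred0//.
by move=> s /=; lia.
Qed.

Lemma tailcount0S b : tailcount b.+1 0 = tailcount b.+1 1.
Proof. by apply: eq_in_count => s /last_bcodesS_gt0 ->. Qed.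

Lemma tailcount_big b v : b.*2.-1 < v -> tailcount b v = 0.
Proof.
move=> bv; rewrite /tailcount (eq_in_count (a2 := pred0)) ?count_pred0//.
by move=> s /last_bcodes /= sb; lia.
Qed.

(** The codes ending in [v.+1] extend exactly those with last entry at least [v]; the bonus entry 2b
    + 1 after a maximal one is excluded by [v < b.*2]. *)
Lemma tailcountS b v : v < b.*2 ->
  tailcount b.+1 v.+1 = tailcount b v + tailcount b.+1 v.+2.
Proof.
move=> vb; rewrite tailcountE count_last_bcodesS//; congr (_ + _).
by apply: eq_in_count => s /last_bcodes sb; case: eqP; lia.
Qed.

(** A maximal entry forces the preceding one to be maximal, which leaves only the code 0, 1, 3, ...,
    2b + 1. *)
Lemma tailcount_top b : tailcount b.+1 b.*2.+1 = 1.
Proof.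
elim: b => [//|b IH].
rewrite tailcountE [X in _ + X]tailcount_big; last lia.
rewrite count_last_bcodesS// addn0 -[RHS]IH.
by apply: eq_in_count => s /last_bcodes sb; case: eqP; lia.
Qed.

(** The recurrence [tailcountS] is Pascal's rule applied at both ends of an interval of binomials.
    The lower sum stands on the left so that nothing is subtracted; it is empty once [v > b]. *)
Lemma tailcount_lowbin b v : v <= b.*2.+1 ->
  tailcount b.+1 v + lowbin (b.*2.+1 - v) (b.+1 - v) = lowbin (b.*2.+1 - v) b.+2.
Proof.
elim: b v => [|b IHb] v.
  by case: v => [|[|]]//; rewrite /lowbin !big_ord_recl !big_ord0.
have top : tailcount b.+2 b.*2.+3 + lowbin (b.*2.+3 - b.*2.+3) (b.+2 - b.*2.+3) =
    lowbin (b.*2.+3 - b.*2.+3) b.+3.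
  have -> : b.*2.+3 = b.+1.*2.+1 by lia.
  rewrite tailcount_top subnn /lowbin.
  have -> : b.+2 - b.+1.*2.+1 = 0 by lia.
  rewrite big_ord0 big_ord_recl big1//.
(* Induction on [m] lowers [v = 2b + 3 - m] from its top value and stops at [v = 1]; the count for 0
   equals the count for 1. *)
have step m : m <= b.*2.+2 ->
    tailcount b.+2 (b.*2.+3 - m) + lowbin m (b.+2 - (b.*2.+3 - m)) =
    lowbin m b.+3.
  elim: m => [|m IHm] mb.
    by rewrite subn0; move: top; rewrite subnn.
  have -> : b.*2.+3 - m.+1 = (b.*2.+1 - m).+1 by lia.
  rewrite tailcountS; last lia.
  have := IHm (ltnW mb); have := IHb (b.*2.+1 - m).
  have -> : b.*2.+3 - m = (b.*2.+1 - m).+2 by lia.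
  have -> : b.*2.+1 - (b.*2.+1 - m) = m by lia.
  rewrite !lowbinS /=.
  have -> : b.+2 - (b.*2.+1 - m).+1 = b.+1 - (b.*2.+1 - m) by lia.
  have -> : b.+2 - (b.*2.+1 - m).+2 = (b.+1 - (b.*2.+1 - m)).-1 by lia.
  by lia.
case: v => [_|v vb]; last first.
  rewrite -(step (b.*2.+3 - v.+1))//; last lia.
  by congr (tailcount _ _ + lowbin _ (_ - _)); lia.
rewrite tailcount0S; have := step b.*2.+2 (leqnn _).
have -> : b.*2.+3 - b.*2.+2 = 1 by lia.
have -> : b.+1.*2.+1 - 0 = b.*2.+3 by lia.
rewrite !lowbinS /= => <-.
have -> : b.+2 - 1 = b.+1 by lia.
rewrite subn0; lia.
Qed.

(** At [v = 0] the two binomial sums differ by a single term. *)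
Lemma size_bcodes n : 0 < n -> size (bcodes n) = 'C(n.*2.-1, n).
Proof.
case: n => // n _; have := tailcount_lowbin (leq0n n.*2.+1).
rewrite /tailcount count_predT !subn0 /lowbin [RHS]big_ord_recr /=.
lia.
Qed.

Lemma bcodes_uniq n : uniq (bcodes n).
Proof.
elim: n => // n IH; apply: allpairs_uniq_dep => //.
  by move=> s _; apply: iota_uniq.
move=> [s v] [t w] _ _ /= /rcons_inj [-> ->] //.
Qed.

Lemma bcodesP n s : reflect
  [/\ size s = n.+1, nth 0 s 0 = 0 &
    forall b, b < n -> 0 < nth 0 s b.+1 <= (nth 0 s b).+1 + ((nth 0 s b).+1 == b.*2)]
  (s \in bcodes n).
Proof.
apply: (iffP idP).
  elim: n s => [|n IH] s; first by rewrite inE => /eqP ->.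
  move=> /allpairsPdep[t [v [/IH [tn t0 tS]]]]; rewrite mem_iota => vt ->.
  rewrite size_rcons tn; split=> // [|b bn]; first by rewrite nth_rcons tn.
  rewrite !nth_rcons tn !ltnS; move: bn; rewrite ltnS leq_eqVlt.
  case/predU1P=> [->|bn]; last first.
    by rewrite bn orbT tS.
  by rewrite !eqxx ltnn; move: vt; rewrite -(nth_last 0) tn /=; lia.
elim: n s => [|n IH] s [].
  by case: s => [|a [|]]//= _ ->; rewrite inE.
elim/last_ind: s => // s v _; rewrite size_rcons => -[sn] s0 sS.
apply/allpairsPdep; exists s, v; split; last by [].
  apply: IH; split=> //; first by move: s0; rewrite nth_rcons sn.
  move=> b bn; have := sS b (ltnW bn); rewrite !nth_rcons sn !ltnS bn (ltnW bn); exact.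
have := sS n (leqnn _); rewrite !nth_rcons sn ltnS leqnn ltnn eqxx.
by rewrite mem_iota -(nth_last 0) sn /=; lia.
Qed.

End CodeCount.

(** * Codes of points of the dominant chamber *)

Section Codes.
Variable R : realFieldType.
Implicit Types (Y : nat -> R) (c : nat -> nat) (b k m n v : nat).

(* With Y_(-j) = - Y_j this is Y_(b - k). *)
Definition sympoint Y b k : R := if (k <= b)%N then Y (b - k)%N else - Y (k - b)%N.

Definition ascending Y n := Y 0%N = 0 /\ forall b, (b < n)%N -> Y b < Y b.+1.

(** The bounds on [k] drop [k = 0], which gives the zero form, and [k = b.*2], which gives twice
    [Y b], not a root of type B. *)
Definition encodes Y n c := forall b k, (b <= n)%N -> (0 < k < b.*2)%N ->
  (Y b - sympoint Y b k < 1) = (k <= c b)%N.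

Lemma sympointSS Y b k : sympoint Y b.+1 k.+1 = sympoint Y b k.
Proof. by rewrite /sympoint ltnS subSS. Qed.

Lemma eq_sympoint Y Z b k : (forall j, (j <= b)%N -> Y j = Z j) -> (k <= b.*2)%N ->
  sympoint Y b k = sympoint Z b k.
Proof. by move=> YZ kb; rewrite /sympoint; case: leqP => kb'; rewrite YZ//; lia. Qed.

Lemma ascending_lt Y n i j : ascending Y n -> (i < j <= n)%N -> Y i < Y j.
Proof.
move=> [_ Yn] /andP[+ jn]; elim: j jn => // j IH jn; rewrite ltnS leq_eqVlt.
case/predU1P=> [->|ij]; first exact: Yn.
by apply: lt_trans (Yn _ jn); apply: IH => //; apply: ltnW.
Qed.

Lemma ascending_ge0 Y n i : ascending Y n -> (i <= n)%N -> 0 <= Y i.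
Proof.
move=> Yn; case: i => [|i] i_n; first by rewrite (proj1 Yn).
by rewrite -(proj1 Yn) ltW// (ascending_lt Yn).
Qed.

(** The points -Y_b < ... < -Y_1 < Y_0 = 0 < Y_1 < ... < Y_b are read from right to left as [k]
    grows. *)
Lemma sympoint_lt Y n b j k : ascending Y n -> (b <= n)%N -> (j < k <= b.*2)%N ->
  sympoint Y b k < sympoint Y b j.
Proof.
move=> Yn bn /andP[jk kb]; rewrite /sympoint; case: (leqP k b) => kb'.
  have -> : (j <= b)%N by lia.
  by apply: (ascending_lt Yn); lia.
have Yk : 0 < Y (k - b)%N by rewrite -(proj1 Yn) (ascending_lt Yn)//; lia.
case: (leqP j b) => jb.
  have : 0 <= Y (b - j)%N by apply: (ascending_ge0 Yn); lia.
  lra.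
by rewrite ltrN2; apply: (ascending_lt Yn); lia.
Qed.

Lemma sympoint_le Y n b j k : ascending Y n -> (b <= n)%N -> (j <= k <= b.*2)%N ->
  sympoint Y b k <= sympoint Y b j.
Proof.
move=> Yn bn /andP[]; rewrite leq_eqVlt => /predU1P[->//|jk kb].
by rewrite ltW// (sympoint_lt Yn)// jk.
Qed.

Lemma downset_threshold (P : pred nat) m :
  (forall j k, (0 < j < k)%N -> (k <= m)%N -> P k -> P j) ->
  exists2 v, (v <= m)%N & forall k, (0 < k <= m)%N -> P k = (k <= v)%N.
Proof.
elim: m => [_|m IH Pm]; first by exists 0%N => // k; lia.
case: (boolP (P m.+1)) => Pm1.
  exists m.+1 => // k /andP[k0 km]; rewrite km; move: km; rewrite leq_eqVlt.
  by case/predU1P=> [->//|km]; apply: (Pm k m.+1) => //; rewrite k0.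
have [|c cm Pc] := IH; first by move=> j k jk km; apply: Pm => //; lia.
exists c; first exact: leqW.
move=> k /andP[k0]; rewrite leq_eqVlt => /predU1P[->|km].
  by rewrite (negbTE Pm1); lia.
by apply: Pc; rewrite k0.
Qed.

Lemma bcodes_nth_le n s b : s \in bcodes n -> (b <= n)%N -> (nth 0%N s b <= b.*2.-1)%N.
Proof.
case/bcodesP=> _ s0 sS; elim: b => [|b IH] bn; first by rewrite s0.
by have := IH (ltnW bn); have := sS _ bn; case: eqP; lia.
Qed.

(** By monotonicity the roots below 1 at level [b] form an initial segment, whose length is the
    entry at [b]; the simple root is [k = 1]. *)
Lemma encodes_bcodes Y n : ascending Y n ->
  (forall b, (b < n)%N -> Y b.+1 - Y b < 1) ->
  exists2 s, s \in bcodes n & encodes Y n (nth 0%N s).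
Proof.
move=> Yn Y1.
have /choice[c Yc] : forall b, exists v, (b <= n)%N -> (v <= b.*2.-1)%N /\
    forall k, (0 < k <= b.*2.-1)%N -> (Y b - sympoint Y b k < 1) = (k <= v)%N.
  move=> b; case: (leqP b n) => bn; last by exists 0%N; lia.
  have [j k jk kb Yk|c cb cP] :=
    @downset_threshold (fun k => Y b - sympoint Y b k < 1) b.*2.-1.
    have : sympoint Y b k < sympoint Y b j by apply: (sympoint_lt Yn) => //; lia.
    by move: Yk; lra.
  by exists c.
have Ymk : encodes Y n (nth 0%N (mkseq c n.+1)).
  by move=> b k bn kb; rewrite nth_mkseq//; apply: (proj2 (Yc b bn)); lia.
exists (mkseq c n.+1) => //; apply/bcodesP; split.
- by rewrite size_mkseq.
- by rewrite nth_mkseq//; have [] := Yc 0%N (leq0n n); lia.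
move=> b bn; rewrite !nth_mkseq; [|lia..].
have [cb cbP] := Yc b (ltnW bn); have [cS cSP] := Yc b.+1 bn.
apply/andP; split.
  rewrite -cSP; last lia.
  by rewrite sympointSS /sympoint leq0n subn0 Y1.
case: eqP => cb2; first lia.
(* A jump by two would put root [c b + 2] of level [b + 1] below 1, although it exceeds root
   [c b + 1] of level [b], which is at least 1. *)
rewrite addn0 leqNgt; apply/negP => cS2.
have : (Y b.+1 - sympoint Y b.+1 (c b).+2 < 1) by rewrite cSP; lia.
case: (posnP b) => [b0|b0]; first by subst b; lia.
have : (Y b - sympoint Y b (c b).+1 < 1) = false by rewrite cbP; lia.
rewrite sympointSS; have := proj2 Yn b bn; lra.
Qed.

(** The entry at [b] is at most [b.*2.-1], so the tests within the range of [encodes] determine it;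
    it suffices to test each entry against the other. *)
Lemma encodes_inj Y n s t : s \in bcodes n -> t \in bcodes n ->
  encodes Y n (nth 0%N s) -> encodes Y n (nth 0%N t) -> s = t.
Proof.
move=> sn tn Ys Yt; have [ss _ _] := bcodesP _ _ sn; have [st _ _] := bcodesP _ _ tn.
apply: (@eq_from_nth _ 0%N); rewrite ss ?st// => b; rewrite ltnS => bn.
have := bcodes_nth_le sn bn; have := bcodes_nth_le tn bn.
have bP k : (0 < k < b.*2)%N -> (k <= nth 0 s b)%N = (k <= nth 0 t b)%N.
  by move=> kb; rewrite -Ys// Yt.
have := bP (nth 0 s b)%N; have := bP (nth 0 t b)%N.
rewrite !leqnn; lia.
Qed.

(* [2 Y_m] is not a root of type B, but when all roots up to level [m] are < 1
   it must be kept < 1 too: [Y_m + Y_(m+1) < 1] forces it. *)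
Lemma encodes_realize_upto n s m : s \in bcodes n -> (m <= n)%N ->
  exists Y, [/\ ascending Y m, encodes Y m (nth 0%N s),
    forall b k, (b <= m)%N -> (0 < k < b.*2)%N -> Y b - sympoint Y b k != 1 &
    (m.*2 <= (nth 0 s m).+1)%N -> Y m < 1 / 2].
Proof.
move=> sn; have [_ s0 sS] := bcodesP _ _ sn; elim: m => [_|m IH mn].
  exists (fun=> 0); split; [by []|by case=> [|b] k; lia..|].
  by move=> _; lra.
have [Y [Ym Ymc Ymn Y2]] := IH (ltnW mn).
have := bcodes_nth_le sn mn; have := bcodes_nth_le sn (ltnW mn).
have {sS} := sS m mn; set c := nth 0%N s in Ymc Y2 *; set v := c m.+1.
move=> /andP[v0 vc] cm vm.
(* The new point [z] must exceed [L], to follow [Y m] and keep root [v + 1] above 1, and stay below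
   [U], to keep root [v] below 1. For maximal [v] there is no root [v + 1], and [U = 1 / 2] secures
   the extra invariant. *)
pose L := if (v <= m.*2)%N then Num.max (Y m) (1 + sympoint Y m v) else Y m.
pose U := if (v <= m.*2)%N then 1 + sympoint Y m v.-1 else 1 / 2.
(* For maximal [v] the right side is [1 - Y m]; then [c m] is maximal too, and the invariant gives
   [Y m < 1 / 2]. *)
have Uv : U <= 1 + sympoint Y m v.-1.
  rewrite /U; case: leqP => // vm'; have -> : v.-1 = m.*2 by lia.
  rewrite /sympoint; case: leqP => m2.
    have -> : m = 0%N by lia.
    by rewrite (proj1 Ym); lra.
  have -> : (m.*2 - m = m)%N by lia.
  have : Y m < 1 / 2 by apply: Y2; lia.
  lra.
have LU : L < U.
  rewrite /L /U; case: leqP => vm'; last first.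
    case: (posnP m) => [m0|m0]; first by rewrite m0 (proj1 Ym); lra.
    by apply: Y2; lia.
  have lt2 : 1 + sympoint Y m v < 1 + sympoint Y m v.-1.
    by rewrite ltrD2l (sympoint_lt Ym)//; lia.
  rewrite gt_max lt2 andbT; case: (posnP v.-1) => v1.
    by rewrite v1 /sympoint leq0n subn0; lra.
  have : Y m - sympoint Y m v.-1 < 1 by rewrite Ymc//; lia.
  lra.
have YmL : Y m <= L by rewrite /L; case: ifP => // _; rewrite le_max lexx.
pose z := (L + U) / 2.
have Lz : L < z by rewrite /z; lra.
have zU : z < U by rewrite /z; lra.
pose Z b := if (b <= m)%N then Y b else z.
have ZY b : (b <= m)%N -> Z b = Y b by rewrite /Z => ->.
have Zz : Z m.+1 = z by rewrite /Z ltnn.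
have gapS k : (0 < k < m.+1.*2)%N -> sympoint Z m.+1 k = sympoint Y m k.-1.
  by case: k => // k km; rewrite sympointSS; apply: eq_sympoint => //; lia.
have gap_lt k : (0 < k < m.+1.*2)%N -> (k <= v)%N -> z - sympoint Y m k.-1 < 1.
  move=> km kv; have := @sympoint_le _ _ m k.-1 v.-1 Ym (leqnn _).
  have -> : (k.-1 <= v.-1 <= m.*2)%N by lia.
  by move=> /(_ isT); lra.
have gap_gt k : (0 < k < m.+1.*2)%N -> (v < k)%N -> 1 < z - sympoint Y m k.-1.
  move=> km kv; have := @sympoint_le _ _ m v k.-1 Ym (leqnn _).
  have -> : (v <= k.-1 <= m.*2)%N by lia.
  move=> /(_ isT); have : 1 + sympoint Y m v <= L.
    rewrite /L; have -> : (v <= m.*2)%N by lia.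
    by rewrite le_max lexx orbT.
  lra.
exists Z; split.
- split=> [|b]; first by rewrite ZY// (proj1 Ym).
  rewrite ltnS leq_eqVlt => /predU1P[->|bm]; first by rewrite Zz ZY//; lra.
  by rewrite !ZY ?(ltnW bm)//; apply: (proj2 Ym).
- move=> b k; rewrite leq_eqVlt => /predU1P[->|bm] km; last first.
    rewrite -Ymc// ZY//; congr (_ - _ < _); apply: eq_sympoint; last lia.
    by move=> j jb; rewrite ZY//; lia.
  rewrite Zz gapS//; case: (leqP k v) => kv; first by rewrite gap_lt.
  by apply/negbTE; rewrite -leNgt ltW// gap_gt.
- move=> b k; rewrite leq_eqVlt => /predU1P[->|bm] km; last first.
    rewrite ZY// (eq_sympoint (Z := Y)) ?Ymn//; last lia.
    by move=> j jb; rewrite ZY//; lia.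
  rewrite Zz gapS//; case: (leqP k v) => kv; first by rewrite lt_eqF ?gap_lt.
  by rewrite gt_eqF ?gap_gt.
- move=> vm2; rewrite Zz; apply: lt_le_trans zU _; rewrite /U.
  by have -> : (v <= m.*2)%N = false by lia.
Qed.

Lemma encodes_realize n s : s \in bcodes n ->
  exists Y, [/\ ascending Y n, encodes Y n (nth 0%N s) &
    forall b k, (b <= n)%N -> (0 < k < b.*2)%N -> Y b - sympoint Y b k != 1].
Proof.
by move=> sn; have [Y [? ? ? _]] := encodes_realize_upto sn (leqnn n); exists Y.
Qed.

End Codes.

(** * Signed coordinates and absolute values *)

Section Pairs.
Variable R : realFieldType.
Implicit Types (a b c t : R).

(* The hyperplanes are [form + c = 0], [c] a level. *)
Definition level c := c \in [:: 1; 0; -1].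

Lemma levelP (P : R -> Prop) : (forall c, level c -> P c) <-> [/\ P 1, P 0 & P (-1)].
Proof.
split=> [Pc|[P1 P0 PN] c]; first by split; apply: Pc; rewrite /level !inE eqxx ?orbT.
by rewrite /level !inE => /or3P[] /eqP->.
Qed.

Lemma levelN c : level (- c) = level c.
Proof. by rewrite /level !inE oppr_eq0 eqr_opp eqr_oppLR orbCA [RHS]orbC -orbA. Qed.

Definition generic1 a := forall c, level c -> a + c != 0.

Definition aligned1 a a' := forall c, level c -> (a + c < 0) = (a' + c < 0).

Lemma generic1_norm a : generic1 `|a| <-> generic1 a.
Proof.
have gN x : generic1 x -> generic1 (- x).
  move=> gx c lc; have -> : - x + c = - (x + - c) by ring.
  by rewrite oppr_eq0 gx ?levelN.
by case: (ger0P a) => _; split=> // /gN //; rewrite opprK.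
Qed.

(** Off the points -1, 0, 1, the intervals they cut out are told apart by the sign and by whether
    the absolute value is below 1. *)
Lemma aligned1P a a' : generic1 a -> generic1 a' ->
  aligned1 a a' <-> (0 < a) = (0 < a') /\ (`|a| < 1) = (`|a'| < 1).
Proof.
rewrite /generic1 !levelP /aligned1 levelP !addr0.
have E1 (x : R) : (x + -1 < 0) = (x < 1) by rewrite subr_lt0.
have E2 (x : R) : (x + 1 < 0) = (x < -1) by apply/idP/idP; lra.
have P (x : R) : x != 0 -> (0 < x) = ~~ (x < 0).
  by move=> x0; rewrite -leNgt lt_neqAle eq_sym x0.
have N (x : R) : x + 1 != 0 -> (- x < 1) = ~~ (x < -1).
  by rewrite addr_eq0 => x1; rewrite -leNgt ltrNl lt_neqAle eq_sym x1.
move=> [a1 a0 aN1] [a'1 a'0 a'N1]; rewrite !E1 !E2 !P//.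
case: (ltrP a 0) => ha; case: (ltrP a' 0) => ha' /=.
- rewrite !ltr0_norm// !N//; split=> [[-> //]|[_ /negb_inj ->]].
  by split=> //; rewrite (lt_trans ha) ?(lt_trans ha').
- by split=> [[]|[]].
- by split=> [[]|[]].
- rewrite !ger0_norm//; split=> [[]//|[_ ->]]; split=> //.
  by apply/idP/idP; lra.
Qed.

Definition generic2 a b := forall c, level c -> a + b + c != 0 /\ a - b + c != 0.

Definition aligned2 a b a' b' := forall c, level c ->
  (a + b + c < 0) = (a' + b' + c < 0) /\ (a - b + c < 0) = (a' - b' + c < 0).

Lemma generic2Nr a b : generic2 a (- b) <-> generic2 a b.
Proof. by split=> ab c /ab[]; rewrite ?opprK. Qed.

Lemma generic2C a b : generic2 a b -> generic2 b a.
Proof.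
move=> ab c lc; split; first by rewrite [b + a]addrC; case: (ab c lc).
have -> : b - a + c = - (a - b + - c) by ring.
by rewrite oppr_eq0; case: (ab (- c)); rewrite ?levelN.
Qed.

Lemma generic2Nl a b : generic2 (- a) b <-> generic2 a b.
Proof.
by split=> /generic2C ?; apply: generic2C; [rewrite -generic2Nr|rewrite generic2Nr].
Qed.

(** Sign changes permute the two forms up to sign, and the levels are symmetric. *)
Lemma generic2_norm a b : generic2 `|a| `|b| <-> generic2 a b.
Proof.
by case: (ger0P a) => _; case: (ger0P b) => _;
  rewrite ?generic2Nr ?generic2Nl ?generic2Nr.
Qed.

Lemma lt0N_neq t : t != 0 -> (- t < 0) = ~~ (t < 0).
Proof. by move=> t0; rewrite oppr_lt0 -leNgt lt_neqAle eq_sym t0. Qed.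

Lemma aligned2Nr a b a' b' : aligned2 a (- b) a' (- b') <-> aligned2 a b a' b'.
Proof. by split=> ab c /ab[]; rewrite ?opprK. Qed.

(** Swapping negates the difference form and its level; genericity turns the negated strict
    inequality into its complement. *)
Lemma aligned2C a b a' b' : generic2 a b -> generic2 a' b' ->
  aligned2 a b a' b' -> aligned2 b a b' a'.
Proof.
move=> gab gab' ab c lc; split; first
  by rewrite ![_ + a]addrC ![_ + a']addrC; case: (ab c lc).
have lc' : level (- c) by rewrite levelN.
have E x y : y - x + c = - (x - y + - c) by ring.
by rewrite !E !lt0N_neq ?(proj2 (gab _ lc')) ?(proj2 (gab' _ lc'))// (proj2 (ab _ lc')).
Qed.

Lemma aligned2Nl a b a' b' : generic2 a b -> generic2 a' b' ->
  aligned2 a b a' b' -> aligned2 (- a) b (- a') b'.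
Proof.
move=> gab gab' ab; apply: aligned2C.
- by rewrite generic2Nr; apply: generic2C.
- by rewrite generic2Nr; apply: generic2C.
by rewrite aligned2Nr; apply: aligned2C.
Qed.

Lemma aligned2NlE a b a' b' : generic2 a b -> generic2 a' b' ->
  aligned2 (- a) b (- a') b' <-> aligned2 a b a' b'.
Proof.
move=> gab gab'; split; last exact: aligned2Nl.
by move/aligned2Nl; rewrite !opprK; apply; rewrite generic2Nl.
Qed.

Lemma aligned2_norm a b a' b' : generic2 a b -> generic2 a' b' ->
  (0 < a) = (0 < a') -> (0 < b) = (0 < b') ->
  aligned2 `|a| `|b| `|a'| `|b'| <-> aligned2 a b a' b'.
Proof.
move=> gab gab'.
by case: (ler0P a) => _; case: (ler0P a') => _; case: (ler0P b) => _ //;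
  case: (ler0P b') => _ //; rewrite ?aligned2Nr ?aligned2NlE ?aligned2Nr ?generic2Nr.
Qed.

(** Of the six comparisons, [a + b] and [a + b + 1] are never negative, and genericity makes
    [a - b + 1 < 0] the complement of [b - a < 1]. *)
Lemma aligned2_posP a b a' b' : 0 < a -> 0 < b -> 0 < a' -> 0 < b' ->
  generic2 a b -> generic2 a' b' ->
  aligned2 a b a' b' <-> [/\ (a < b) = (a' < b'), (a + b < 1) = (a' + b' < 1),
    (a - b < 1) = (a' - b' < 1) & (b - a < 1) = (b' - a' < 1)].
Proof.
move=> a0 b0 a'0 b'0 gab gab'; rewrite /aligned2 levelP.
have E0 (x y : R) : (x - y + 0 < 0) = (x < y) by apply/idP/idP; lra.
have E1 (x y : R) : (x - y + -1 < 0) = (x - y < 1) by apply/idP/idP; lra.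
have S1 (x y : R) : (x + y + -1 < 0) = (x + y < 1) by apply/idP/idP; lra.
have N1 x y : generic2 x y -> (x - y + 1 < 0) = ~~ (y - x < 1).
  move=> gxy; rewrite -leNgt le_eqVlt.
  have /negbTE -> : 1 != y - x.
    have l1 : level 1 by rewrite /level inE eqxx.
    by apply: contra (proj2 (gxy 1 l1)) => /eqP ->; apply/eqP; ring.
  by apply/idP/idP; lra.
have P0 (x y c : R) : 0 < x -> 0 < y -> 0 <= c -> (x + y + c < 0) = false.
  by move=> *; lra.
rewrite !E0 !E1 !S1 !N1// !P0 ?ler01//.
by split=> [[[_ /negb_inj->] [_ ->] [-> ->]]//|[-> -> -> ->]].
Qed.

(** The sums stay positive at every level and the difference does not change. *)
Lemma shift_both a b t : 1 < a -> 1 < b -> 0 <= t -> generic2 a b ->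
  generic2 (a + t) (b + t) /\ aligned2 a b (a + t) (b + t).
Proof.
move=> a1 b1 t0 gab; have E c : a + t - (b + t) + c = a - b + c by ring.
have P c x y : level c -> 1 < x -> 1 < y -> 0 < x + y + c.
  by move: c; rewrite levelP; split=> x1 y1; lra.
split=> c lc; rewrite E; split=> //.
- by rewrite gt_eqF// P//; lra.
- by have [] := gab c lc.
- by rewrite !ltNge !ltW// P//; lra.
Qed.

(** A gap above 1 keeps every form positive at every level. *)
Lemma shift_one a b t : 0 < b -> b + 1 < a -> 0 <= t ->
  generic2 (a + t) b /\ aligned2 a b (a + t) b.
Proof.
move=> b0 ba t0.
have P c x : level c -> b + 1 < x -> 0 < x + b + c /\ 0 < x - b + c.
  by move: c; rewrite levelP; split=> bx; split; lra.
have at1 : b + 1 < a + t by lra.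
split=> c lc; have [s1 d1] := P c (a + t) lc at1; first by rewrite !gt_eqF.
by have [s2 d2] := P c a lc ba; rewrite !ltNge !ltW.
Qed.

End Pairs.

(** * Sorting the absolute values *)

Section Ranks.
Variables (n : nat).
Implicit Types (p q : {perm 'I_n}) (i j : 'I_n).

Lemma card_perm_lt p i : #|[pred j | (p j < p i)%N]| = p i.
Proof.
rewrite -sum1_card (reindex_inj (@perm_inj _ p^-1%g)) /=.
under eq_bigl => j do rewrite inE permKV.
by rewrite (big_ord_narrow (ltnW (ltn_ord (p i)))) sum1_card card_ord.
Qed.

Lemma perm_lt_inj p q :
  (forall i j, (p i < p j)%N = (q i < q j)%N) -> p = q.
Proof.
move=> pq; apply/permP => i; apply: val_inj.
rewrite /= -[LHS]card_perm_lt -[RHS]card_perm_lt.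
by apply: eq_card => j; rewrite !inE pq.
Qed.

Lemma rank_perm (R : realDomainType) (u : 'I_n -> R) : injective u ->
  exists p, forall i j, (u i < u j) = (p i < p j)%N.
Proof.
move=> u_inj; pose f i := #|[pred j | u j < u i]|.
have f_lt i j : u i < u j -> (f i < f j)%N.
  move=> ij; apply: proper_card; apply/properP; split.
    by apply/fintype.subsetP => k; rewrite !inE => /lt_trans; apply.
  by exists i; rewrite !inE ?ltxx.
have fn i : (f i < n)%N.
  rewrite -[X in (_ < X)%N]card_ord; apply: proper_card; apply/properP; split.
    by apply/fintype.subsetP.
  by exists i; rewrite ?inE ?ltxx.
have f_inj : injective (fun i => Ordinal (fn i)).
  move=> i j [fij]; apply: u_inj; case: (ltgtP (u i) (u j)) => // /f_lt;
    by rewrite fij ltnn.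
exists (perm f_inj) => i j; rewrite !permE /=.
case: (ltgtP (u i) (u j)) => [/f_lt->//|/f_lt ji|/u_inj->]; last by rewrite ltnn.
by apply/esym/negbTE; rewrite -leqNgt ltnW.
Qed.

End Ranks.

(** * Codes of families of positive numbers *)

Section Sorting.
Variables (R : realFieldType) (n : nat).
Implicit Types (u v : 'I_n -> R) (p : {perm 'I_n}) (i j : 'I_n) (c : nat -> nat).

(* [sortedby u p b] is the value [u i] of rank [b] (ranks start at 1), and 0
   for [b = 0]. *)
Definition sortedby u p (b : nat) : R := \sum_(i | (p i).+1 == b) u i.

Lemma sortedby0 u p : sortedby u p 0 = 0.
Proof. by rewrite /sortedby big1. Qed.

Lemma sortedbyS u p i : sortedby u p (p i).+1 = u i.
Proof.
rewrite /sortedby (big_pred1 i)// => j /=.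
by rewrite eqSS (inj_eq val_inj) (inj_eq perm_inj).
Qed.

Lemma rankP p b : (0 < b <= n)%N -> exists i, b = (p i).+1.
Proof.
case: b => // b bn; exists (p^-1 (Ordinal bn))%g; by rewrite permKV.
Qed.

Lemma ascending_sortedby u p : ascending (sortedby u p) n <->
  (forall i, 0 < u i) /\ forall i j, (u i < u j) = (p i < p j)%N.
Proof.
split=> [asc|[u0 up]]; last first.
  split=> [|b bn]; first exact: sortedby0.
  have [i Ei] := @rankP p b.+1 bn; rewrite Ei sortedbyS.
  case: b bn Ei => [|b] bn Ei; first by rewrite sortedby0.
  have [j Ej] := @rankP p b.+1 (ltnW bn); rewrite Ej sortedbyS up; lia.
have lt i j : (p i < p j)%N -> u i < u j.
  move=> ij; rewrite -(sortedbyS u p i) -(sortedbyS u p j) (ascending_lt asc)//.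
  by rewrite ltnS ij ltn_ord.
split=> [i|i j].
  by rewrite -(sortedbyS u p i) -(proj1 asc) (ascending_lt asc)//= ltn_ord.
case: (ltngtP (p i) (p j)) => [/lt->//|/lt/ltW|/val_inj/perm_inj->]; last by rewrite ltxx.
by rewrite leNgt => /negbTE.
Qed.

(** At level [(p i).+1], the index [k] equal to this rank gives [u i] itself; smaller [k] give
    differences and larger [k] give sums with values of lower rank. *)
Lemma encodes_sortedby u p c : encodes (sortedby u p) n c <->
  (forall i, (u i < 1) = ((p i).+1 <= c (p i).+1)%N) /\
  forall i j, (p j < p i)%N ->
    (u i - u j < 1) = (p i - p j <= c (p i).+1)%N /\
    (u i + u j < 1) = ((p i).+1 + (p j).+1 <= c (p i).+1)%N.
Proof.
have s0 i : sympoint (sortedby u p) (p i).+1 (p i).+1 = 0.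
  by rewrite /sympoint leqnn subnn sortedby0.
have sB i j : (p j < p i)%N -> sympoint (sortedby u p) (p i).+1 (p i - p j) = u j.
  move=> ij; rewrite /sympoint; have -> : (p i - p j <= (p i).+1)%N by lia.
  by rewrite -(sortedbyS u p j); congr (sortedby u p _); lia.
have sD i j : sympoint (sortedby u p) (p i).+1 ((p i).+1 + (p j).+1) = - u j.
  rewrite /sympoint; have -> : ((p i).+1 + (p j).+1 <= (p i).+1)%N = false by lia.
  by rewrite -(sortedbyS u p j); congr (- sortedby u p _); lia.
split=> [uc|[u1 u2] b k bn kb].
  split=> [i|i j ij].
    by rewrite -uc ?ltn_ord//; [rewrite s0 sortedbyS subr0|lia].
  rewrite -!uc ?ltn_ord//; [|lia..].
  by rewrite sB// sD sortedbyS opprK.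
have [|i Eb] := @rankP p b; first lia.
subst b; rewrite sortedbyS; case: (ltngtP k (p i).+1) => ki.
- have [|j Ej] := @rankP p ((p i).+1 - k)%N; first lia.
  have ij : (p j < p i)%N by lia.
  have -> : k = (p i - p j)%N by lia.
  by rewrite sB// (proj1 (u2 i j ij)).
- have [|j Ej] := @rankP p (k - (p i).+1)%N; first by have := ltn_ord (p i); lia.
  have ij : (p j < p i)%N by lia.
  have -> : k = ((p i).+1 + (p j).+1)%N by lia.
  by rewrite sD opprK (proj2 (u2 i j ij)).
- by rewrite ki s0 subr0 u1.
Qed.

Definition positions_generic u :=
  (forall i, generic1 (u i)) /\ forall i j, i != j -> generic2 (u i) (u j).

Definition positions_aligned u v :=
  (forall i, (u i < 1) = (v i < 1)) /\
  forall i j, i != j -> aligned2 (u i) (u j) (v i) (v j).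

Definition coded u p (s : seq nat) :=
  ascending (sortedby u p) n /\ encodes (sortedby u p) n (nth 0%N s).

(** A code fixes the order and the comparisons of roots with 1; by [aligned2_posP] alignment fixes
    the same data. *)
Lemma coded_aligned u v p s : positions_generic u -> positions_generic v ->
  (forall i, 0 < u i) -> (forall i, 0 < v i) ->
  coded u p s -> coded v p s <-> positions_aligned u v.
Proof.
move=> [gu1 gu2] [gv1 gv2] u0 v0 [/ascending_sortedby[_ up] /encodes_sortedby[u1 ub]].
have alP i j (ij : i != j) :=
  aligned2_posP (u0 i) (u0 j) (v0 i) (v0 j) (gu2 i j ij) (gv2 i j ij).
split.
  move=> [/ascending_sortedby[_ vp] /encodes_sortedby[v1 vb]].
  split=> [i|i j ij]; first by rewrite u1 v1.
  apply/alP => //; rewrite up vp; split=> //.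
  - case: (ltngtP (p i) (p j)) => [ji|ij'|/val_inj/perm_inj Eij].
    + by rewrite addrC (proj2 (ub _ _ ji)) addrC (proj2 (vb _ _ ji)).
    + by rewrite (proj2 (ub _ _ ij')) (proj2 (vb _ _ ij')).
    + by rewrite Eij eqxx in ij.
  - case: (ltngtP (p i) (p j)) => [ji|ij'|/val_inj/perm_inj Eij].
    (* Both differences are negative here, hence below 1. *)
    + have := up i j; have := vp i j; rewrite ji => v_ij u_ij.
      by apply/idP/idP => _; lra.
    + by rewrite (proj1 (ub _ _ ij')) (proj1 (vb _ _ ij')).
    + by rewrite Eij eqxx in ij.
  - case: (ltngtP (p j) (p i)) => [ji|ij'|/val_inj/perm_inj Eij].
    + have := up j i; have := vp j i; rewrite ji => v_ij u_ij.
      by apply/idP/idP => _; lra.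
    + by rewrite (proj1 (ub _ _ ij')) (proj1 (vb _ _ ij')).
    + by rewrite Eij eqxx in ij.
move=> [uv1 uv2]; split.
  apply/ascending_sortedby; split=> // i j.
  by case: (eqVneq i j) => [->|/[dup] ij /uv2/alP[//|<-]]; rewrite ?ltxx ?ltnn.
apply/encodes_sortedby; split=> [i|i j ij]; first by rewrite -uv1.
have ij' : i != j by apply: contraTneq ij => ->; rewrite ltnn.
by have /alP[//|_ <- <- _] := uv2 i j ij'; apply: ub.
Qed.

Lemma coded_inj u p q s t : s \in bcodes n -> t \in bcodes n ->
  coded u p s -> coded u q t -> p = q /\ s = t.
Proof.
move=> sn tn [pu us] [qu ut].
have pq : p = q.
  apply: perm_lt_inj => i j.
  have [_ <-] := proj1 (ascending_sortedby _ _) pu.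
  by have [_ <-] := proj1 (ascending_sortedby _ _) qu.
by rewrite -pq in ut; split=> //; apply: encodes_inj sn tn us ut.
Qed.

(** Positive entries make consecutive sorted values differ by less than 1, and these gaps add up
    from 0. *)
Lemma coded_le u p s i : s \in bcodes n -> coded u p s -> u i <= n%:R.
Proof.
move=> /bcodesP[_ _ sS] [asc us].
have Yb b : (b <= n)%N -> sortedby u p b <= b%:R.
  elim: b => [|b IH] bn; first by rewrite sortedby0.
  have : sortedby u p b.+1 - sympoint (sortedby u p) b.+1 1 < 1.
    by rewrite us//; have := sS b bn; lia.
  by rewrite sympointSS /sympoint leq0n subn0; have := IH (ltnW bn); rewrite -natr1; lra.
rewrite -(sortedbyS u p); apply: le_trans (Yb _ (ltn_ord _)) _.
by rewrite ler_nat ltn_ord.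
Qed.

(** The last hypothesis bounds every simple root by 1 without naming the sorting: a [u j] below
    [u i] is at most the predecessor of [u i]. *)
Lemma coded_exists u : injective u -> (forall i, 0 < u i) ->
  (forall i, u i < 1 \/ exists j, u j < u i < u j + 1) ->
  exists p, exists2 s, s \in bcodes n & coded u p s.
Proof.
move=> u_inj u0 u1; have [p up] := rank_perm u_inj.
have asc : ascending (sortedby u p) n by apply/ascending_sortedby.
have [b bn|s sn us] := encodes_bcodes asc; last by exists p, s.
have [i Ei] := @rankP p b.+1 bn; rewrite Ei sortedbyS.
have Y0 := ascending_ge0 asc (ltnW bn).
case: (u1 i) => [|[j /andP[ji ij]]]; first lra.
suff : u j <= sortedby u p b by lra.
rewrite -(sortedbyS u p j); move: ji; rewrite up => ji.
have : ((p j).+1 <= b)%N by lia.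
rewrite leq_eqVlt => /predU1P[->//|jb].
by rewrite ltW// (ascending_lt asc)// jb ltnW.
Qed.

Lemma coded_realize p s : s \in bcodes n ->
  exists u, [/\ forall i, 0 < u i, positions_generic u & coded u p s].
Proof.
move=> sn; have [Y [asc Ys Yn1]] := encodes_realize R sn.
pose u i := Y (p i).+1.
have uY b : (b <= n)%N -> sortedby u p b = Y b.
  case: b => [|b] bn; first by rewrite sortedby0 (proj1 asc).
  by have [i ->] := @rankP p b.+1 bn; rewrite sortedbyS.
have u0 i : 0 < u i by rewrite /u -(proj1 asc) (ascending_lt asc)//= ltn_ord.
have uasc : ascending (sortedby u p) n.
  by split=> [|b bn]; rewrite ?sortedby0// !uY ?(proj2 asc)// ltnW.
exists u; split=> //; last first.
  split=> // b k bn kb; rewrite -Ys// uY// (eq_sympoint (Z := Y)); [by []| |lia].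
  by move=> j jb; rewrite uY//; lia.
split=> [i|i j].
  have ui := u0 i; apply/levelP; split; [by rewrite gt_eqF//; lra..|].
  have := Yn1 (p i).+1 (p i).+1 (ltn_ord _).
  rewrite /sympoint leqnn subnn (proj1 asc) subr0 subr_eq0.
  by apply; lia.
wlog ij : i j / (p j < p i)%N => [ijP ij|_].
  case: (ltngtP (p j) (p i)) => [/ijP|/ijP ji|/val_inj/perm_inj Eij]; first exact.
    by apply: generic2C; apply: ji; rewrite eq_sym.
  by rewrite Eij eqxx in ij.
have ui := u0 i; have uj := u0 j.
have uij : u j < u i by apply: (ascending_lt asc); rewrite ltnS ij ltn_ord.
(* Sums and differences are positive at levels 1 and 0; only at level -1 must the root be known to
   avoid 1. *)
apply/levelP; split; split; try by rewrite gt_eqF//; lra.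
  have := Yn1 (p i).+1 ((p i).+1 + (p j).+1)%N (ltn_ord _); rewrite /sympoint.
  have -> : ((p i).+1 + (p j).+1 <= (p i).+1)%N = false by lia.
  by rewrite addKn opprK subr_eq0; apply; lia.
have := Yn1 (p i).+1 (p i - p j)%N (ltn_ord _); rewrite /sympoint.
have -> : (p i - p j <= (p i).+1)%N by lia.
have -> : ((p i).+1 - (p i - p j) = (p j).+1)%N by lia.
by rewrite subr_eq0; apply; lia.
Qed.

End Sorting.

(** * Regions as sets of constant side *)

Section Cells.
Variables (R : realType) (n : nat).
Implicit Types (x y a : 'rV[R]_n) (h : 'rV[R]_n * R) (A : arrangement R n).

Definition dotp a x : R := \sum_(i < n) a 0 i * x 0 i.

Lemma dotp_continuous a : continuous (dotp a).
Proof.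
move=> x; apply: (cvg_big (@add_continuous R^o) (nbhs_filter x)) => i _.
by apply: cvgM; [exact: cvg_cst | exact: coord_continuous].
Qed.

Lemma dotp_segment a x y t :
  dotp a (x + t *: (y - x)) = dotp a x + t * (dotp a y - dotp a x).
Proof.
rewrite /dotp -sumrB mulr_sumr -big_split; apply: eq_bigr => i _ /=.
by rewrite !mxE; ring.
Qed.

Lemma arr_complementP A x :
  arr_complement A x <-> forall h, h \in A -> dotp h.1 x != h.2.
Proof.
split=> [Ax h hA|Ax [h hA hx]].
  by apply/eqP => hx; apply: Ax; exists h.
by move/negP: (Ax h hA); apply; apply/eqP.
Qed.

Definition same_side A x y :=
  forall h, h \in A -> (dotp h.1 x < h.2) = (dotp h.1 y < h.2).

(** A linear form maps a connected set to an interval, which here avoids the value of the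
    hyperplane; conversely, a segment whose ends lie on the same sides meets no hyperplane. *)
Lemma connected_component_same_side A x : arr_complement A x ->
  connected_component (arr_complement A) x =
  [set y | arr_complement A y /\ same_side A x y].
Proof.
move=> Ax; apply/seteqP; split=> y /=.
  move=> [C [Cx CA Cc] Cy]; split; first exact: CA.
  move=> h hA.
  have /connected_intervalP itv : connected (dotp h.1 @` C).
    apply: connected_continuous_connected => //.
    exact/continuous_subspaceT/dotp_continuous.
  have nC z : C z -> dotp h.1 z != h.2.
    by move=> /CA /arr_complementP; apply.
  have cross z w : C z -> C w -> dotp h.1 z < h.2 -> dotp h.1 w < h.2.
    move=> Cz Cw zh; rewrite ltNge; apply/negP => hw.
    have [|v Cv hv] := itv _ _ (imageP _ Cz) (imageP _ Cw) h.2.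
      by rewrite (ltW zh).
    by have := nC _ Cv; rewrite hv eqxx.
  by apply/idP/idP; apply: cross.
move=> [Ay xy].
exists ((fun t : R => x + t *: (y - x)) @` `[0, 1]); last first.
  by exists 1 => /=; rewrite ?in_itv /= ?ler01 ?lexx// scale1r addrC subrK.
split.
- by exists 0 => /=; rewrite ?in_itv /= ?ler01 ?lexx// scale0r addr0.
- move=> _ [t + <-]; rewrite /= in_itv /= => /andP[t0 t1].
  apply/arr_complementP => h hA; rewrite dotp_segment.
  have := xy h hA; have /arr_complementP/(_ h hA) := Ax.
  have /arr_complementP/(_ h hA) := Ay.
  move: t1; rewrite le_eqVlt => /predU1P[-> yh _ _|t1].
    by rewrite mul1r addrC subrK.
  case: (ltgtP (dotp h.1 y)) => // yh _; case: (ltgtP (dotp h.1 x)) => // xh _ _.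
    by rewrite lt_eqF//; nra.
  by rewrite gt_eqF//; nra.
apply: connected_continuous_connected; first exact: segment_connected.
apply: continuous_subspaceT => t; apply: cvgD; first exact: cvg_cst.
by apply: cvgZl; exact: cvg_id.
Qed.

Lemma rV_norm_leP x (M : R) : 0 <= M -> (forall i, `|x 0 i| <= M) -> `|x| <= M.
Proof.
move=> M0 xM; rewrite /Num.norm /= /mx_norm -[M]/((NngNum M0)%:num) num_le.
apply/bigmax_leP; split=> [|[i j] _ /=]; first by rewrite -num_le.
by rewrite -num_le /= ord1.
Qed.

Lemma rV_coord_le x i : `|x 0 i| <= `|x|.
Proof.
rewrite [leRHS]/Num.norm /= /mx_norm -[leLHS]nngE num_le.
exact: (le_bigmax _ (fun i => `|x i.1 i.2|%:nng) (0, i)).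
Qed.

Lemma bounded_setP (C : set 'rV[R]_n) :
  bounded_set C <-> exists M, forall x, C x -> forall i, `|x 0 i| <= M.
Proof.
split=> [/pinfty_ex_gt0[M M0 CM]|[M CM]].
  by exists M => x Cx i; apply: le_trans (rV_coord_le _ _) (CM _ Cx).
exists (Num.max M 0); split; first exact: num_real.
move=> N MN x Cx /=; have [N0 NM] : 0 <= N /\ M <= N.
  by move: MN; rewrite gt_max => /andP[/ltW -> /ltW ->].
by apply: rV_norm_leP => // i; apply: le_trans NM; exact: CM.
Qed.

End Cells.

(** * The type B Catalan arrangement *)

Section CatalanB.
Variables (R : realType) (n : nat).
Implicit Types (x y : 'rV[R]_n) (i j : 'I_n).

Definition center x i : R := x 0 i + 1 / 2.

Definition radius x i : R := `|center x i|.

Lemma dotp_delta i x : dotp (delta_mx 0 i) x = x 0 i.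
Proof.
rewrite /dotp (bigD1 i)//= big1 => [|j ji]; first by rewrite mxE !eqxx mul1r addr0.
by rewrite mxE (negbTE ji) andbF mul0r.
Qed.

Lemma dotpD a b x : dotp (a + b) x = dotp a x + dotp b x.
Proof. by rewrite /dotp -big_split; apply: eq_bigr => i _; rewrite mxE mulrDl. Qed.

Lemma dotpN a x : dotp (- a) x = - dotp a x.
Proof. by rewrite /dotp -sumrN; apply: eq_bigr => i _; rewrite mxE mulNr. Qed.

(** With [P] a relation, non-vanishing at one point and equality of sides for two points are both
    instances. *)
Lemma catalanB_forall (P : R -> R -> Prop) x y :
  (forall h, h \in catalanB R n -> P (dotp h.1 x - h.2) (dotp h.1 y - h.2)) <->
  (forall i c, level c -> P (center x i + c) (center y i + c)) /\
  (forall i j, (i < j)%N -> forall c, level c ->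
    P (center x i + center x j + c) (center y i + center y j + c) /\
    P (center x i - center x j + c) (center y i - center y j + c)).
Proof.
have ltE i j : (i < j)%N -> (i, j) \in
    [seq p : 'I_n * 'I_n <- enum {: 'I_n * 'I_n} | (p.1 < p.2)%N].
  by move=> ij; rewrite mem_filter ij mem_enum.
split=> [H|[H1 H2] h].
  have H' a b : (a, b) \in catalanB R n -> P (dotp a x - b) (dotp a y - b).
    exact: (H (a, b)).
  split=> [i|i j ij].
    have Hi b : b \in [:: - (3 / 2); - (1 / 2); 1 / 2] -> P (x 0 i - b) (y 0 i - b).
      move=> bl; rewrite -!dotp_delta; apply: H'; rewrite mem_cat; apply/orP; left.
      by apply/allpairsP; exists (i, b); rewrite mem_enum.
    apply/levelP; split.
    - have := Hi (- (3 / 2)); rewrite !inE eqxx => /(_ isT).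
      by congr P; rewrite /center; lra.
    - have := Hi (- (1 / 2)); rewrite !inE eqxx orbT => /(_ isT).
      by congr P; rewrite /center; lra.
    - have := Hi (1 / 2); rewrite !inE eqxx !orbT => /(_ isT).
      by congr P; rewrite /center; lra.
  have HD b : b \in [:: -2; -1; 0] -> P (x 0 i + x 0 j - b) (y 0 i + y 0 j - b).
    move=> bl; rewrite -!dotp_delta -!dotpD; apply: H'.
    rewrite !mem_cat; apply/or3P; apply: Or32.
    by apply/allpairsP; exists ((i, j), b); split=> //; apply: ltE.
  have HB b : b \in [:: -1; 0; 1] -> P (x 0 i - x 0 j - b) (y 0 i - y 0 j - b).
    move=> bl; rewrite -!dotp_delta -!dotpN -!dotpD; apply: H'.
    rewrite !mem_cat; apply/or3P; apply: Or33.
    by apply/allpairsP; exists ((i, j), b); split=> //; apply: ltE.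
  apply/levelP; split; split.
  - have := HD (-2); rewrite !inE eqxx => /(_ isT).
    by congr P; rewrite /center; lra.
  - have := HB (-1); rewrite !inE eqxx => /(_ isT).
    by congr P; rewrite /center; lra.
  - have := HD (-1); rewrite !inE eqxx orbT => /(_ isT).
    by congr P; rewrite /center; lra.
  - have := HB 0; rewrite !inE eqxx orbT => /(_ isT).
    by congr P; rewrite /center; lra.
  - have := HD 0; rewrite !inE eqxx !orbT => /(_ isT).
    by congr P; rewrite /center; lra.
  - have := HB 1; rewrite !inE eqxx !orbT => /(_ isT).
    by congr P; rewrite /center; lra.
rewrite !mem_cat => /or3P[] /allpairsP[].
- move=> [i b] /= [_ bl ->] /=; rewrite !dotp_delta.
  have [c lc [-> ->]] : exists2 c, level c &
      x 0 i - b = center x i + c /\ y 0 i - b = center y i + c.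
    (* Passing to centers shifts x_i by 1/2, x_i + x_j by 1 and x_i - x_j by 0; this gives the level
       in each of the three families. *)
    exists (- b - 1 / 2); last by rewrite /center; split; ring.
    move: bl; rewrite !inE /level !inE => /or3P[] /eqP->; apply/or3P;
      [apply: Or31|apply: Or32|apply: Or33]; apply/eqP; lra.
  exact: H1.
- move=> [[i j] b] /= [ij bl ->] /=; rewrite !dotpD !dotp_delta.
  move: ij; rewrite mem_filter /= => /andP[ij _].
  have [c lc [-> ->]] : exists2 c, level c &
      x 0 i + x 0 j - b = center x i + center x j + c /\
      y 0 i + y 0 j - b = center y i + center y j + c.
    exists (- b - 1); last by rewrite /center; split; lra.
    move: bl; rewrite !inE /level !inE => /or3P[] /eqP->; apply/or3P;
      [apply: Or31|apply: Or32|apply: Or33]; apply/eqP; lra.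
  by have [] := H2 i j ij c lc.
- move=> [[i j] b] /= [ij bl ->] /=; rewrite !dotpD !dotpN !dotp_delta.
  move: ij; rewrite mem_filter /= => /andP[ij _].
  have [c lc [-> ->]] : exists2 c, level c &
      x 0 i - x 0 j - b = center x i - center x j + c /\
      y 0 i - y 0 j - b = center y i - center y j + c.
    exists (- b); last by rewrite /center; split; lra.
    move: bl; rewrite !inE /level !inE => /or3P[] /eqP->; apply/or3P;
      [apply: Or31|apply: Or32|apply: Or33]; apply/eqP; lra.
  by have [] := H2 i j ij c lc.
Qed.

Lemma catalanB_complementP x :
  arr_complement (catalanB R n) x <-> positions_generic (radius x).
Proof.
rewrite arr_complementP.
have -> : (forall h, h \in catalanB R n -> dotp h.1 x != h.2) <->
    (forall h, h \in catalanB R n -> dotp h.1 x - h.2 != 0).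
  by split=> H h /H; rewrite subr_eq0.
rewrite (catalanB_forall (fun t _ => t != 0) x x); split.
  move=> [g1 g2]; split=> [i|i j ij]; first by apply/generic1_norm => c; apply: g1.
  apply/generic2_norm; case: (ltngtP i j) => [ij'|ij'|/val_inj Eij].
  - by move=> c; apply: g2.
  - by apply: generic2C => c; apply: g2.
  - by rewrite Eij eqxx in ij.
move=> [g1 g2]; split=> [i c lc|i j ij c lc].
  exact: (proj1 (generic1_norm _) (g1 i)).
apply: (proj1 (generic2_norm _ _) (g2 i j _)) => //.
by apply: contraTneq ij => ->; rewrite ltnn.
Qed.

(** By [aligned1P] and [aligned2_norm] a side pattern splits into the signs of the centers and the
    pattern of the radii. *)
Lemma catalanB_same_sideP x y :
  arr_complement (catalanB R n) x -> arr_complement (catalanB R n) y ->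
  same_side (catalanB R n) x y <->
  (forall i, (0 < center x i) = (0 < center y i)) /\
  positions_aligned (radius x) (radius y).
Proof.
move=> /catalanB_complementP[gx1 gx2] /catalanB_complementP[gy1 gy2].
have -> : same_side (catalanB R n) x y <->
    (forall h, h \in catalanB R n -> (dotp h.1 x - h.2 < 0) = (dotp h.1 y - h.2 < 0)).
  by split=> H h /H; rewrite !subr_lt0.
rewrite (catalanB_forall (fun s t => (s < 0) = (t < 0)) x y).
have al1 i :=
  aligned1P (proj1 (generic1_norm _) (gx1 i)) (proj1 (generic1_norm _) (gy1 i)).
have c2x i j (ij : i != j) := proj1 (generic2_norm _ _) (gx2 i j ij).
have c2y i j (ij : i != j) := proj1 (generic2_norm _ _) (gy2 i j ij).
split=> [[a1 a2]|[sg [a1 a2]]].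
  have sg i : (0 < center x i) = (0 < center y i) by have /al1[] := a1 i.
  split=> //; split=> [i|i j ij]; first by have /al1[] := a1 i.
  apply/aligned2_norm; [exact: c2x|exact: c2y|exact: sg|exact: sg|].
  case: (ltngtP i j) => [ij'|ij'|/val_inj Eij].
  - exact: a2.
  - by rewrite eq_sym in ij; apply: aligned2C; [exact: c2x|exact: c2y|exact: a2].
  - by rewrite Eij eqxx in ij.
split=> [i|i j ij]; first exact: (proj2 (al1 i) (conj (sg i) (a1 i))).
have ij' : i != j by apply: contraTneq ij => ->; rewrite ltnn.
exact: (proj1 (aligned2_norm (c2x _ _ ij') (c2y _ _ ij') (sg i) (sg j)) (a2 _ _ ij')).
Qed.

(** The normals include the standard basis, so boundedness of a region is ordinary boundedness. *)
Lemma normal_span_catalanB x : x \in normal_span (catalanB R n).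
Proof.
rewrite [x]row_sum_delta; apply: memv_suml => i _; apply: memvZ.
apply: memv_span; apply/mapP; exists (delta_mx 0 i, 1 / 2) => //.
rewrite mem_cat; apply/orP; left; apply/allpairsP; exists (i, 1 / 2).
by rewrite mem_enum !inE eqxx !orbT.
Qed.

(** * Bounded regions indexed by order, signs and chamber code *)

Definition code : Type := ({perm 'I_n} * {ffun 'I_n -> bool}) * seq nat.

Definition code_region (k : code) : set 'rV[R]_n :=
  [set x | [/\ arr_complement (catalanB R n) x,
    forall i, (0 < center x i) = k.1.2 i & coded (radius x) k.1.1 k.2]].

Lemma radius_gt0 x i : positions_generic (radius x) -> 0 < radius x i.
Proof.
move=> [g1 _]; rewrite lt_neqAle normr_ge0 andbT eq_sym.
by have /levelP[_ + _] := g1 i; rewrite addr0.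
Qed.

(** Signs and coded radii are a complete invariant of the side pattern, which in turn separates
    components. *)
Lemma code_region_component k x : code_region k x ->
  connected_component (arr_complement (catalanB R n)) x = code_region k.
Proof.
move=> [Ax sx cx]; rewrite connected_component_same_side//.
have gx := proj1 (catalanB_complementP x) Ax.
apply/seteqP; split=> y /=.
  move=> [Ay /(catalanB_same_sideP Ax Ay)[sxy axy]].
  have gy := proj1 (catalanB_complementP y) Ay.
  split=> [//|i|]; first by rewrite -sxy.
  by apply/(coded_aligned gx gy _ _ cx) => // i; apply: radius_gt0.
move=> [Ay sy cy]; have gy := proj1 (catalanB_complementP y) Ay.
split=> //; apply/(catalanB_same_sideP Ax Ay); split=> [i|]; first by rewrite sx sy.
by apply/(coded_aligned gx gy _ _ cx) => // i; apply: radius_gt0.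
Qed.

Lemma code_region_nonempty k : k.2 \in bcodes n -> code_region k !=set0.
Proof.
move=> /(coded_realize R k.1.1)[u [u0 gu cu]].
(* The realizing radii receive the prescribed signs and are translated back. *)
pose x := \row_i ((if k.1.2 i then u i else - u i) - 1 / 2) : 'rV[R]_n.
have cx i : center x i = if k.1.2 i then u i else - u i.
  by rewrite /center mxE subrK.
have rx : radius x = u.
  by apply/funext => i; rewrite /radius cx; case: ifP; rewrite ?normrN gtr0_norm.
exists x; split; rewrite ?rx//; first by apply/catalanB_complementP; rewrite rx.
by move=> i; rewrite cx; case: ifP => _; rewrite ?u0// oppr_gt0 ltNge ltW.
Qed.

Lemma code_region_bounded k : k.2 \in bcodes n -> bounded_set (code_region k).
Proof.
move=> ks; apply/bounded_setP; exists (n%:R + 1 / 2) => x [_ _ cx] i.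
have -> : x 0 i = center x i - 1 / 2 by rewrite /center addrK.
apply: le_trans (ler_normB _ _) _; rewrite lerD ?(coded_le _ ks cx)//.
by rewrite ger0_norm//; lra.
Qed.

(* Otherwise all centers at distance at least [radius x i] from 0 can be
   moved away from 0 by an arbitrary common amount without meeting a
   hyperplane. *)
Lemma bounded_component_radius x i : arr_complement (catalanB R n) x ->
  bounded_set (connected_component (arr_complement (catalanB R n)) x) ->
  radius x i < 1 \/ exists j, radius x j < radius x i < radius x j + 1.
Proof.
move=> Ax /bounded_setP[M]; rewrite connected_component_same_side// => bM.
have gx := proj1 (catalanB_complementP x) Ax; have [g1 g2] := gx.
have r0 j := radius_gt0 j gx.
case: (ltrP (radius x i) 1) => [?|ri]; first by left.
have {}ri : 1 < radius x i.
  rewrite lt_neqAle ri andbT eq_sym -subr_eq0.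
  by have /levelP[] := g1 i.
case: (pselect (exists j, radius x j < radius x i < radius x j + 1)); first by right.
move=> /forallNP gap; exfalso.
(* Equality is excluded because it would put [x] on a hyperplane. *)
have {}gap j : radius x j < radius x i -> radius x j + 1 < radius x i.
  move=> ji; have := gap j; rewrite ji /= => /negP; rewrite -leNgt le_eqVlt.
  have ij : i != j by apply: contraTneq ji => ->; rewrite ltxx.
  case/predU1P => // E; have /levelP[_ _ [_]] := g2 i j ij.
  by rewrite -E => /eqP[]; ring.
(* Radius [i] will exceed [|M| + 2], whereas the bound [M] on coordinates allows at most
   [M + 1 / 2]. *)
pose t := `|M| + 1; have t0 : 0 <= t by rewrite /t addr_ge0.
pose d j := if radius x i <= radius x j then t else 0.
have d0 j : 0 <= d j by rewrite /d; case: ifP.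
pose y := \row_j (x 0 j + Num.sg (center x j) * d j) : 'rV[R]_n.
have cy j : center y j = center x j + Num.sg (center x j) * d j.
  by rewrite /center mxE addrAC.
have ry j : radius y j = radius x j + d j.
  rewrite /radius cy {1}[center x j]numEsg -mulrDr normrM normr_sg.
  rewrite -normr_gt0 (r0 j) mul1r ger0_norm// addr_ge0//.
have sy j : (0 < center x j) = (0 < center y j).
  rewrite cy; have := r0 j; rewrite /radius normr_gt0.
  have dj := d0 j.
  case: (ltrgtP 0 (center x j)) => // cj _.
    by rewrite gtr0_sg// mul1r; apply/esym; lra.
  by rewrite ltr0_sg//; apply/esym/negbTE; rewrite -leNgt; lra.
(* Two moved radii keep their difference, a moved and a fixed one are more than 1 apart by [gap],
   and two fixed ones do not change. *)
have gal j k : j != k -> generic2 (radius y j) (radius y k) /\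
    aligned2 (radius x j) (radius x k) (radius y j) (radius y k).
  move=> jk; have gjk := g2 _ _ jk; rewrite !ry /d.
  case: (leP (radius x i) (radius x j)) => ij;
    case: (leP (radius x i) (radius x k)) => ik.
  - by apply: shift_both => //; lra.
  - by rewrite addr0; apply: shift_one => //; have := gap k ik; lra.
  - have [|gkj akj] := @shift_one _ (radius x k) (radius x j) t (r0 j) _ t0.
      by have := gap j ij; lra.
    rewrite addr0; split; first exact: generic2C.
    by apply: aligned2C => //; apply: generic2C.
  - by rewrite !addr0.
have Ay : arr_complement (catalanB R n) y.
  apply/catalanB_complementP; split=> [j|j k /gal[]//].
  rewrite ry /d; case: (leP (radius x i) (radius x j)) => [ij|_]; last by rewrite addr0.
  by apply/levelP; split; rewrite gt_eqF//; lra.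
have xy : same_side (catalanB R n) x y.
  apply/catalanB_same_sideP => //; split=> //; split=> [j|j k /gal[]//].
  rewrite ry /d; case: (leP (radius x i) (radius x j)) => [ij|_]; last by rewrite addr0.
  by apply/idP/idP; lra.
have := bM y (conj Ay xy) i; have := ry i; rewrite /d lexx /radius.
have : `|center y i| <= `|y 0 i| + 1 / 2.
  by apply: le_trans (ler_normD _ _) _; rewrite lerD2l ger0_norm//; lra.
have := ler_norm M; have := r0 i; rewrite /t /radius; lra.
Qed.

Lemma bounded_region_catalanB :
  bounded_region (catalanB R n) = code_region @` [set k : code | k.2 \in bcodes n].
Proof.
have nsT : [set y | y \in normal_span (catalanB R n)] = setT.
  by apply/seteqP; split=> y //= _; apply: normal_span_catalanB.
rewrite /bounded_region nsT; apply/seteqP; split=> [C|_ [k kn <-]] /=.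
  move=> [[x Ax <-]]; rewrite setIT => bC.
  have gx := proj1 (catalanB_complementP x) Ax; have [g1 g2] := gx.
  (* Equal radii would put [x] on a hyperplane of level 0. *)
  have inj : injective (radius x).
    move=> i j Eij; apply/eqP; apply/negP => /negP ij.
    by have /levelP[_ [_ + _]] := g2 i j ij; rewrite Eij addr0 subrr eqxx.
  have [||p [s sn cx]] := @coded_exists _ _ (radius x) inj.
  - by move=> i; apply: radius_gt0.
  - by move=> i; apply: bounded_component_radius.
  exists ((p, [ffun i => 0 < center x i]), s) => //.
  by apply/esym/code_region_component; split=> // i; rewrite ffunE.
have [x kx] := code_region_nonempty kn.
split; first by exists x; [case: kx | exact: code_region_component].
by rewrite setIT; apply: code_region_bounded.
Qed.

(** A point of the common region determines the signs, the permutation and the chamber code. *)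
Lemma code_region_inj : {in [set k : code | k.2 \in bcodes n] &, injective code_region}.
Proof.
move=> [[p e] s] [[q f] t]; rewrite !inE /= => sn tn E.
have [x kx] := @code_region_nonempty ((p, e), s) sn.
have := kx; rewrite E => -[_ fx tx]; case: kx => _ ex sx.
have [/= -> ->] := coded_inj sn tn sx tx.
congr (_, _, _); apply/ffunP => i; exact: etrans (esym (ex i)) (fx i).
Qed.

End CatalanB.

Local Open Scope card_scope.

Theorem theorem5p13 (R : realType) (n : nat) (n_ge1 : (1 <= n)%N) :
  bounded_region (catalanB R n) #= `I_(2 ^ n * n`! * 'C(2 * n - 1, n))%N.
Proof.
pose L : seq (code n) :=
  [seq (a, s) | a <- enum {: {perm 'I_n} * {ffun 'I_n -> bool}}, s <- bcodes n].
have Ls : size L = (2 ^ n * n`! * 'C(2 * n - 1, n))%N.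
  rewrite size_allpairs -cardE card_prod card_Sn card_ffun card_bool card_ord.
  by rewrite size_bcodes// [(n`! * _)%N]mulnC subn1 mul2n.
have Lu : uniq L.
  apply: allpairs_uniq; [exact: enum_uniq|exact: bcodes_uniq|].
  by move=> [? ?] [? ?] _ _ [-> ->].
have Lmem k : (k \in L) = (k.2 \in bcodes n).
  apply/allpairsP/idP => [[[a s] [_ /= sn ->]]//|kn].
  by exists k; split=> //; [rewrite mem_enum | case: k kn].
pose k0 : code n := ((1%g, [ffun=> false]), [::]).
rewrite bounded_region_catalanB.
apply: card_eq_trans (inj_card_eq (@code_region_inj R n)) _.
(* Positions in the duplicate-free list [L] number the codes; below its size the default [k0] is
   never reached. *)
have -> : [set k : code n | k.2 \in bcodes n] = nth k0 L @` `I_(size L).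
  apply/seteqP; split=> [k /=|_ [i iL <-]] /=.
    by rewrite -Lmem => kL; exists (index k L); rewrite /= ?index_mem ?nth_index.
  by rewrite -Lmem mem_nth.
rewrite -Ls; apply: inj_card_eq => i j; rewrite !inE /= => iL jL /eqP.
by rewrite nth_uniq// => /eqP.
Qed.
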